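(* Let $\alpha\in[0,\frac12]$, let $\hat S_n=\big(\frac{n(n+1)}{2}\big)^2$ for $n\ge1$, and let $A=\{A_n\}_{n\ge 0}$ be a finitely supported complex sequence with $A_0=0$. Then $$\sum_{n=1}^{\infty}\frac{\hat S_n^{\alpha}|A_n-A_{n-1}|^2}{n^3}\ \ge\ \sum_{n=1}^{\infty}\hat w_n(n^3,S)|A_n|^2\ >\ \frac{(\alpha-1)^2}{4}\sum_{n=1}^{\infty}\frac{n^3}{\hat S_n^{2-\alpha}}|A_n|^2,$$ where, for $n\ge1$, $$\hat w_n(n^3,S)=\frac{\hat S_n^{\alpha}}{n^3}\Big[1+\Big(\frac{n}{n+1}\Big)^{3}\Big(\frac{n+2}{n}\Big)^{2\alpha}-\Big(\frac{n-1}{n+1}\Big)^{1-\alpha}-\Big(\frac{n}{n+1}\Big)^{3}\Big(\frac{n+2}{n}\Big)^{1+\alpha}\Big].$$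
   Context: A sequence $\{A_n\}_{n\ge0}$ is finitely supported if $A_n\ne0$ for only finitely many $n$.
   Formalization: The strict second inequality is stated only for sequences A that are not identically zero, since for A = 0 both sides equal 0 and the strict inequality fails; the first inequality is stated for all A. *)

(* Defs.v *)
From HB Require Import structures.
From mathcomp Require Import all_boot all_order all_algebra.
From mathcomp Require Import all_classical all_reals all_analysis.
From mathcomp Require Import complex.

Set Implicit Arguments.
Unset Strict Implicit.
Unset Printing Implicit Defensive.

Import Order.TTheory GRing.Theory Num.Theory.
Import numFieldNormedType.Exports.

Local Open Scope classical_set_scope.
Local Open Scope ring_scope.

Notation "\sum_ ( m <= i '<oo' ) F" :=
  (\big[+%R/0%R]_(m <= i <oo) F%R) : ring_scope.

Definition finitely_supported (R : realType) (A : nat -> R[i]) : Prop :=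
  finite_set [set n | A n != 0].

Definition Shat (R : realType) (n : nat) : R :=
  (n%:R * (n%:R + 1) / 2) ^+ 2.

(* In powR, 0 `^ p is 0 for p != 0, so for n = 1 and alpha < 1 the term
   ((n - 1) / (n + 1)) `^ (1 - alpha) is 0, as it should be. *)
Definition what (R : realType) (alpha : R) (n : nat) : R :=
  Shat R n `^ alpha / n%:R ^+ 3 *
  (1 + (n%:R / (n%:R + 1)) ^+ 3 * ((n%:R + 2) / n%:R) `^ (2 * alpha)
   - ((n%:R - 1) / (n%:R + 1)) `^ (1 - alpha)
   - (n%:R / (n%:R + 1)) ^+ 3 * ((n%:R + 2) / n%:R) `^ (1 + alpha)).

(* Main.v *)
Require Import Defs.
From HB Require Import structures.
From mathcomp Require Import all_boot all_order all_algebra.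
From mathcomp Require Import all_classical all_reals all_analysis.
From mathcomp Require Import complex.
From mathcomp Require Import ring lra.

Import Order.TTheory GRing.Theory Num.Theory.
Import numFieldNormedType.Exports.

Local Open Scope classical_set_scope.
Local Open Scope ring_scope.

(** The sequence [phi_n = Shat_n ^ ((1 - alpha) / 2)] is a ground state: with
    [v_n = Shat_n ^ alpha / n^3] and [rho_n = phi_(n-1) / phi_n], the weight is
    [what_n = v_n (1 - rho_n) + v_(n+1) (1 - 1 / rho_(n+1))], and AM-GM gives
    [(c - d)^2 >= (1 - rho) c^2 + (1 - 1 / rho) d^2], which sums up to the first
    inequality.  The second one holds termwise.  With [x = 1 / (n + 1)],
    [b = 1 - alpha] and [y = ((1 - x) / (1 + x)) ^ b] it reads
    [4 b^2 x^2 (1 - x)^2 < 1 - (1 - 2 x)^b - (1 - x) (1 + x)^2 y (1 - y)];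
    both sides agree to order [x^2], and replacing the two real powers by Taylor
    bounds that are exact to that order leaves a polynomial inequality. *)

(** * Taylor bounds for real powers *)

Lemma is_derive_ln_comp (R : realType) (g : R -> R) (dg t : R) :
  0 < g t -> is_derive t 1 g dg ->
  is_derive t 1 (fun u => ln (g u)) (dg / g t).
Proof.
move=> gt0 dgt; rewrite mulrC.
exact: (@is_derive1_comp _ (@ln R) g t _ _ (is_derive1_ln gt0) dgt).
Qed.

Lemma derive_le0_le_at0 (R : realType) (f df : R -> R) (c : R) :
  0 <= c -> (forall t, 0 <= t <= c -> is_derive t 1 f (df t)) ->
  (forall t, 0 <= t <= c -> df t <= 0) -> f c <= f 0.
Proof.
move=> c0 fdf df_le0.
have [t||t] := @MVT_segment R f df 0 c c0.
- by rewrite in_itv/= => /andP[t0 tc]; apply: fdf; rewrite !ltW.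
- apply: derivable_within_continuous => t.
  by rewrite in_itv/= => /fdf[].
rewrite in_itv/= => /df_le0 dft /eqP; rewrite subr0 subr_eq => /eqP ->.
by rewrite gerDr mulr_le0_ge0.
Qed.

(** The logarithms of both sides agree at [s = 0]; the sign of the derivative of their difference
    comes down to [b * (1 - b) * t ^+ 2 * (1 - b / 2) >= 0]. *)
Lemma one_sub_powR_le (R : realType) (b s : R) :
  0 < b <= 1 -> 0 <= s <= 1 ->
  (1 - s) `^ b <= 1 - b * s - b * (1 - b) / 2 * s ^+ 2.
Proof.
(* The endpoint [s = 1] admits no logarithm and is treated apart; it occurs for [n = 1], where
   [1 - 2 * x] vanishes. *)
move=> /andP[b0 b1] /andP[s0]; rewrite le_eqVlt => /predU1P[->|s1].
  rewrite subrr powR0 ?gt_eqF//; nra.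
pose M (t : R) : R := 1 - b * t - b * (1 - b) / 2 * t ^+ 2.
have M_gt0 t : 0 <= t <= s -> 0 < M t.
  move=> /andP[t0 ts]; rewrite /M.
  (* [M t] is the first of the next three expressions plus half the sum of the other two. *)
  have : 0 < b * (1 - t) by rewrite mulr_gt0//; lra.
  have : 0 <= b * (1 - b) * (1 - t ^+ 2) by rewrite !mulr_ge0//; nra.
  have : 0 <= (1 - b) * (2 - b) by rewrite mulr_ge0//; lra.
  lra.
rewrite -/(M s) -ler_ln ?posrE ?M_gt0 ?s0 ?powR_gt0 ?subr_gt0 ?lexx//.
rewrite ln_powR -subr_le0.
pose f (t : R) : R := b * ln (1 - t) - ln (M t).
pose df (t : R) := - b / (1 - t) - (- b - b * (1 - b) * t) / M t.
have -> : 0 = f 0 by rewrite /f /M !(mulr0, subr0, expr0n)/= ln1 mulr0 subr0.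
apply: (@derive_le0_le_at0 _ f df) => // t /andP[t0 ts].
  have Mt : 0 < M t by rewrite M_gt0// t0.
  have t1 : 0 < 1 - t by lra.
  have dM : is_derive t 1 M (- b - b * (1 - b) * t).
    by rewrite /M; apply: is_derive_eq; rewrite /GRing.scale/=; field.
  have dlnM := is_derive_ln_comp _ _ _ _ Mt dM.
  have d1 : is_derive t 1 (fun u : R => 1 - u) (-1).
    by apply: is_derive_eq; ring.
  have dln1 := is_derive_ln_comp _ (fun u => 1 - u) _ _ t1 d1.
  rewrite /f; apply: is_derive_eq.
  by rewrite /df /GRing.scale/=; field; rewrite !gt_eqF.
have Mt : 0 < M t by rewrite M_gt0// t0.
have t1 : 0 < 1 - t by lra.
rewrite /df subr_le0 ler_pdivrMr// mulrAC ler_pdivlMr// -subr_ge0.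
rewrite [leRHS](_ : _ = b * (1 - b) * t ^+ 2 * (1 - b / 2)).
  by rewrite !mulr_ge0 ?sqr_ge0//; lra.
by rewrite /M; field.
Qed.

(* The Taylor expansion has cubic coefficient [- (2 b + 4 b^3) / 3], which is at
   least [- 2 b^2] exactly when [b] lies in [[1/2, 1]] (for [b > 0]). *)
Lemma ratio_powR_ge (R : realType) (b x : R) :
  1 / 2 <= b <= 1 -> 0 <= x <= 1 / 2 ->
  1 - 2 * b * x + 2 * b ^+ 2 * x ^+ 2 - 2 * b ^+ 2 * x ^+ 3 <=
  ((1 - x) / (1 + x)) `^ b.
Proof.
move=> /andP[b0 b1] /andP[x0 x1].
pose L (t : R) : R :=
  1 - 2 * b * t + 2 * b ^+ 2 * t ^+ 2 - 2 * b ^+ 2 * t ^+ 3.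
have L_gt0 t : 0 <= t <= x -> 0 < L t.
  move=> /andP[t0 tx]; rewrite /L.
  (* [L t] equals [(1 - b * t) ^+ 2 + b ^+ 2 * t ^+ 2 * (1 - 2 * t)]. *)
  have bt : b * t <= 1 * (1 / 2) by rewrite ler_pM//; lra.
  have : 0 < (1 - b * t) ^+ 2 by rewrite exprn_gt0//; lra.
  have : 0 <= b ^+ 2 * t ^+ 2 * (1 - 2 * t).
    by rewrite !mulr_ge0 ?sqr_ge0//; lra.
  lra.
have x1n : 0 < 1 - x by lra.
have x1p : 0 < 1 + x by lra.
rewrite -/(L x) -ler_ln ?posrE ?L_gt0 ?x0 ?powR_gt0 ?divr_gt0 ?lexx//.
rewrite ln_powR ln_div// -subr_le0.
pose f (t : R) : R := ln (L t) - b * (ln (1 - t) - ln (1 + t)).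
pose dL (t : R) := - 2 * b + 4 * b ^+ 2 * t - 6 * b ^+ 2 * t ^+ 2.
pose df (t : R) := dL t / L t + 2 * b / ((1 - t) * (1 + t)).
have -> : 0 = f 0.
  by rewrite /f /L !(mulr0, subr0, addr0, expr0n)/= ln1 subrr mulr0 subr0.
apply: (@derive_le0_le_at0 _ f df) => // t /andP[t0 tx].
  have Lt : 0 < L t by rewrite L_gt0// t0.
  have t1n : 0 < 1 - t by lra.
  have t1p : 0 < 1 + t by lra.
  have dLt : is_derive t 1 L (dL t).
    rewrite /L; apply: is_derive_eq; rewrite /GRing.scale/= /dL.
    by field.
  have dn : is_derive t 1 (fun u : R => 1 - u) (-1).
    by apply: is_derive_eq; ring.
  have dp : is_derive t 1 (fun u : R => 1 + u) 1.
    by apply: is_derive_eq; ring.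
  have dlnL := is_derive_ln_comp _ _ _ _ Lt dLt.
  have dlnn := is_derive_ln_comp _ (fun u => 1 - u) _ _ t1n dn.
  have dlnp := is_derive_ln_comp _ (fun u => 1 + u) _ _ t1p dp.
  rewrite /f; apply: is_derive_eq.
  by rewrite /df /GRing.scale/=; field; rewrite !gt_eqF.
have Lt : 0 < L t by rewrite L_gt0// t0.
have t1 : 0 < (1 - t) * (1 + t) by rewrite mulr_gt0//; lra.
rewrite /df -lerBrDr sub0r -mulNr ler_pdivrMr// mulrAC ler_pdivlMr// -subr_ge0.
(* The first summand is nonnegative because [1/2 <= b <= 1], the second because [6 * t <= 3]. *)
have -> : - (2 * b) * L t - dL t * ((1 - t) * (1 + t)) =
    t ^+ 2 * (2 * b * (2 * b - 1) * (1 - b)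
       + t * b ^+ 2 * (4 + 4 * b - 6 * t)) by rewrite /L /dL; ring.
rewrite mulr_ge0 ?sqr_ge0// addr_ge0// !mulr_ge0 ?sqr_ge0//; lra.
Qed.

(** * Termwise comparison of the two weights *)

(** The terms in [b] and [x] alone on the right come from [one_sub_powR_le] at [s = 2 * x]. Once [y]
    is eliminated, all orders up to [x ^+ 2] cancel and [b * x ^+ 3 * Q] remains. *)
Lemma weight_key_ineq (R : realFieldType) (b x y : R) :
  1 / 2 <= b <= 1 -> 0 < x <= 1 / 2 ->
  1 - 2 * b * x + 2 * b ^+ 2 * x ^+ 2 - 2 * b ^+ 2 * x ^+ 3 <= y ->
  4 * b ^+ 2 * x ^+ 2 * (1 - x) ^+ 2 <
  2 * b * x + 2 * b * (1 - b) * x ^+ 2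
  - (1 - x) * (1 + x) ^+ 2 * (y * (1 - y)).
Proof.
move=> /andP[b0 b1] /andP[x0 x1] Ly.
pose s := 2 * b * x.
pose y0 := 1 - s + s ^+ 2 / 2.
(* [y * (1 - y)] lies below its tangent at [y0], whose slope is
   [- (1 - s) ^+ 2 <= 0], so the lower bound on [y] can be plugged in. *)
have yle : y * (1 - y) <=
    y0 * (1 - y0) + (1 - s) ^+ 2 * (2 * b ^+ 2 * x ^+ 3).
  have : 0 <= (1 - s) ^+ 2 * (y - y0 + 2 * b ^+ 2 * x ^+ 3).
    rewrite mulr_ge0 ?sqr_ge0//; move: Ly; rewrite /y0 /s; lra.
  have := sqr_ge0 (y - y0).
  rewrite /y0; nra.
have c0 : 0 <= (1 - x) * (1 + x) ^+ 2 by rewrite mulr_ge0 ?sqr_ge0//; lra.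
apply: (@lt_le_trans _ _ (2 * b * x + 2 * b * (1 - b) * x ^+ 2
  - (1 - x) * (1 + x) ^+ 2 *
    (y0 * (1 - y0) + (1 - s) ^+ 2 * (2 * b ^+ 2 * x ^+ 3)))); last first.
  by rewrite lerB// ler_wpM2l.
rewrite -subr_gt0.
(* The bounds below give [Q >= 6 - 6 * x - 8 / 16 > 0]. *)
pose Q := (2 + 12 * b - 8 * b ^+ 2) - x * (12 * b - 2 - 4 * b ^+ 3)
  + x ^+ 2 * b * (16 * b - 4 - 4 * b ^+ 2 - 12 * b ^+ 2 * x)
  + 2 * b * x ^+ 3 + 8 * b ^+ 3 * x ^+ 5 - 8 * b ^+ 2 * x ^+ 4
  + 4 * b ^+ 3 * x ^+ 4.
rewrite [ltRHS](_ : _ = b * x ^+ 3 * Q); last by rewrite /Q /y0 /s; field.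
have bp : 0 < b by lra.
have b2 : 0 <= (2 * b - 1) * (1 - b) by rewrite mulr_ge0//; lra.
have x4 : b ^+ 2 * x ^+ 4 <= 1 * (1 / 2) ^+ 4.
  by rewrite ler_pM ?exprn_ge0 ?exprn_ile1 ?lerXn2r ?nnegrE//; lra.
have h1 : 6 <= 2 + 12 * b - 8 * b ^+ 2 by nra.
have h2 : x * (12 * b - 2 - 4 * b ^+ 3) <= x * 6.
  rewrite ler_pM2l// -subr_ge0 [leRHS](_ : _ = 4 * (1 - b) ^+ 2 * (2 + b)).
    by rewrite mulr_ge0 ?mulr_ge0 ?sqr_ge0//; lra.
  by ring.
have h3 : 0 <= x ^+ 2 * b * (16 * b - 4 - 4 * b ^+ 2 - 12 * b ^+ 2 * x).
  rewrite mulr_ge0 ?mulr_ge0 ?sqr_ge0 ?ltW//.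
  have : 0 <= b ^+ 2 * (1 / 2 - x) by rewrite mulr_ge0 ?sqr_ge0//; lra.
  lra.
have h4 : 0 <= b * x ^+ 3 by rewrite mulr_ge0 ?exprn_ge0 ?ltW.
have h5 : 0 <= b ^+ 3 * x ^+ 5 by rewrite mulr_ge0 ?exprn_ge0 ?ltW.
have h6 : 0 <= b ^+ 3 * x ^+ 4 by rewrite mulr_ge0 ?exprn_ge0 ?ltW.
rewrite !mulr_gt0 ?exprn_gt0// /Q.
move: x4; have -> : (1 / 2 : R) ^+ 4 = 1 / 16 by field.
lra.
Qed.

Lemma Shat_gt0 (R : realType) (n : nat) : (0 < n)%N -> 0 < Shat R n.
Proof.
by move=> n0; rewrite exprn_gt0// divr_gt0// mulr_gt0 ?natr1 ?ltr0n.
Qed.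

Lemma hardy_weight_lt_what (R : realType) (alpha : R) (n : nat) :
  0 <= alpha <= 1 / 2 -> (0 < n)%N ->
  (alpha - 1) ^+ 2 / 4 * (n%:R ^+ 3 / Shat R n `^ (2 - alpha)) < what alpha n.
Proof.
move=> /andP[a0 a1] n0.
have S_gt0 := Shat_gt0 R n n0.
have n1 : 1 <= n%:R :> R by rewrite ler1n.
pose b := 1 - alpha.
have hb : 1 / 2 <= b <= 1 by rewrite /b; lra.
pose x : R := 1 / (n%:R + 1).
have np : 0 < n%:R + 1 :> R by lra.
have x01 : 0 < x <= 1 / 2.
  rewrite /x divr_gt0//= ler_pdivrMr//; lra.
have nE : n%:R = (1 - x) / x by rewrite /x; field; lra.
have [x0 x1] := andP x01.
pose y := ((1 - x) / (1 + x)) `^ b.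
have yL : 1 - 2 * b * x + 2 * b ^+ 2 * x ^+ 2 - 2 * b ^+ 2 * x ^+ 3 <= y.
  by apply: ratio_powR_ge => //; rewrite ltW.
have key := weight_key_ineq _ _ _ _ hb x01 yL.
have z_le : (1 - 2 * x) `^ b <= 1 - 2 * b * x - 2 * b * (1 - b) * x ^+ 2.
  apply: le_trans (one_sub_powR_le _ b (2 * x) _ _) _; rewrite ?lexx; lra.
pose q : R := (n%:R + 2) / n%:R.
have q_gt0 : 0 < q by rewrite divr_gt0//; lra.
(* Here [(1 - x) / (1 + x)] is [1 / q]; as [2 * alpha = 2 - 2 * b] and [1 + alpha = 2 - b], both
   powers of [q] in the weight become monomials in [q] and [y]. *)
have yE : y = q `^ (- b).
  rewrite -mulN1r powRrM powR_inv1; last exact: ltW.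
  by congr (_ `^ _); rewrite /q nE; field; lra.
have q2 : q `^ 2 = q ^+ 2 by rewrite powR_mulrn// ltW.
have qa1 : q `^ (2 * alpha) = q ^+ 2 * y ^+ 2.
  rewrite yE -q2 -powR_mulrn ?powR_ge0// -powRrM -powRD; last first.
    by rewrite (gt_eqF q_gt0) implybT.
  by congr (_ `^ _); rewrite /b; ring.
have qa2 : q `^ (1 + alpha) = q ^+ 2 * y.
  rewrite yE -q2 -powRD; last by rewrite (gt_eqF q_gt0) implybT.
  by congr (_ `^ _); rewrite /b; ring.
have -> : Shat R n `^ (2 - alpha) = Shat R n ^+ 2 / Shat R n `^ alpha.
  by rewrite powRD ?(gt_eqF S_gt0) ?implybT// powRN powR_mulrn// ltW.
rewrite /what -/q qa1 qa2 -/b.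
have Sa : 0 < Shat R n `^ alpha by rewrite powR_gt0.
set v := Shat R n `^ alpha in Sa *.
have -> : (n%:R - 1) / (n%:R + 1) = 1 - 2 * x by rewrite nE; field; lra.
(* Uses [n ^ 6 / Shat_n ^ 2 = 16 * n ^ 2 / (n + 1) ^ 4 = 16 * x ^ 2 * (1 - x) ^ 2]. *)
rewrite [ltLHS](_ : _ =
    v / n%:R ^+ 3 * (4 * b ^+ 2 * x ^+ 2 * (1 - x) ^+ 2)); last first.
  rewrite /Shat nE /b; field.
  by rewrite !gt_eqF//; lra.
rewrite ltr_pM2l ?divr_gt0 ?exprn_gt0//; last lra.
apply: lt_le_trans key _.
set z := _ `^ b in z_le *.
rewrite [leRHS](_ : _ = 1 - z - (1 - x) * (1 + x) ^+ 2 * (y * (1 - y))).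
  by rewrite lerB//; lra.
by rewrite /q nE; field; lra.
Qed.

(** * Ground state representation and summation *)

(** With [q = (n + 2) / n], [Shat_(n+1) = q ^ 2 * Shat_n] and [1 / rho_(n+1) = q ^ (1 - alpha)], so
    the four terms match those of the bracket. *)
Lemma what_ground_state (R : realType) (alpha : R) (n : nat) : (0 < n)%N ->
  let v k := Shat R k `^ alpha / k%:R ^+ 3 in
  let rho k := ((k%:R - 1) / (k%:R + 1)) `^ (1 - alpha) in
  what alpha n = v n * (1 - rho n) + v n.+1 * (1 - (rho n.+1)^-1).
Proof.
move=> n0 v rho.
have n1 : 1 <= n%:R :> R by rewrite ler1n.
pose q : R := (n%:R + 2) / n%:R.
have q_gt0 : 0 < q by rewrite divr_gt0//; lra.
have SE : Shat R n.+1 = Shat R n * q `^ 2.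
  rewrite powR_mulrn ?ltW// /Shat /q -natr1; field.
  by rewrite gt_eqF//; lra.
have vE : v n.+1 =
    Shat R n `^ alpha / n%:R ^+ 3 *
    ((n%:R / (n%:R + 1)) ^+ 3 * q `^ (2 * alpha)).
  rewrite /v SE powRM ?powR_ge0 ?ltW ?Shat_gt0// -powRrM -natr1.
  by field; rewrite !gt_eqF//; lra.
have rhoE : (rho n.+1)^-1 = q `^ (1 - alpha).
  rewrite /rho -powRN -(mulN1r (1 - alpha)) powRrM powR_inv1; last first.
    by rewrite -natr1 divr_ge0//; lra.
  by congr (_ `^ _); rewrite /q -natr1; field; rewrite !gt_eqF//; lra.
have qE : q `^ (1 + alpha) = q `^ (2 * alpha) * q `^ (1 - alpha).
  rewrite -powRD; last by rewrite (gt_eqF q_gt0) implybT.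
  by congr (_ `^ _); ring.
by rewrite vE rhoE /what /= -/q qE -/(rho n) /v; ring.
Qed.

(** The gap is [r * (c - d / r) ^+ 2], which vanishes when [d = r * c], as for the ground state. *)
Lemma sqrB_ge_ground_state (R : realFieldType) (r c d : R) :
  0 < r -> (1 - r) * c ^+ 2 + (1 - r^-1) * d ^+ 2 <= (c - d) ^+ 2.
Proof.
move=> r0; rewrite -subr_ge0 [leRHS](_ : _ = r * (c - d / r) ^+ 2).
  by rewrite mulr_ge0 ?sqr_ge0// ltW.
by field; rewrite gt_eqF.
Qed.

(** The boundary term is the half of the weight at [N + 1] already produced by the difference
    [a (N + 1) - a N]; the next difference supplies the other half, which closes the induction. *)
Lemma ground_state_partial_sum (R : realFieldType) (v rho T a : nat -> R)
    (N : nat) :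
  (forall n, (0 < n)%N -> 0 <= v n) ->
  (forall n, (1 < n)%N -> 0 < rho n) -> rho 1%N = 0 ->
  a 0%N = 0 ->
  (forall n, (0 < n)%N -> v n * (a n - a n.-1) ^+ 2 <= T n) ->
  \sum_(1 <= n < N.+1)
     (v n * (1 - rho n) + v n.+1 * (1 - (rho n.+1)^-1)) * a n ^+ 2
  + v N.+1 * (1 - rho N.+1) * a N.+1 ^+ 2 <= \sum_(1 <= n < N.+2) T n.
Proof.
move=> v_ge0 rho_gt0 rho1 a0 hT; elim: N => [|N IH].
  rewrite big_geq// big_nat1 add0r rho1 subr0 mulr1.
  by have := hT 1%N isT; rewrite /= a0 subr0.
rewrite big_nat_recr//= [leRHS]big_nat_recr//=.
have h := hT N.+2 isT.
have := sqrB_ge_ground_state _ _ (a N.+2) (a N.+1) (rho_gt0 N.+2 isT).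
move=> /(ler_wpM2l (v_ge0 N.+2 isT)) /= h'.
rewrite mulrDr in h'; move: IH h h' => /=; lra.
Qed.

(** * Reduction to finite sums and conclusion *)

Lemma series_finite_support (R : realType) (u : nat -> R) (N : nat) :
  (forall n, (N <= n)%N -> u n = 0) ->
  \sum_(1 <= n <oo) u n = \sum_(1 <= n < N.+1) u n.
Proof.
move=> u0; apply: lim_near_cst => //.
exists N.+1 => // m /= Nm.
rewrite (@big_cat_nat _ _ _ N.+1)//= [X in _ + X]big_nat_cond.
rewrite [X in _ + X]big1 ?addr0//.
by move=> i /andP[/andP[Ni _] _]; rewrite u0// ltnW.
Qed.

Lemma finitely_supported_bound (R : realType) (A : nat -> R[i]) :
  finitely_supported A -> exists N, forall n, (N <= n)%N -> A n = 0.
Proof.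
move=> /finite_seqP[s sE]; exists (\max_(i <- s) i).+1 => n Nn.
apply/eqP/negPn/negP => An.
have : n \in s by have : [set n | A n != 0] n by []; rewrite sE.
move=> sn; have : (n <= \max_(i <- s) i)%N by exact: leq_bigmax_seq.
by rewrite leqNgt Nn.
Qed.

(** Strictness is stated for nonzero [A]: for [A = 0] both sides vanish. *)
Theorem theorem3p7 (R : realType) (alpha : R) (A : nat -> R[i])
    (halpha : 0 <= alpha <= 1 / 2)
    (hA : finitely_supported A)
    (hA0 : A 0%N = 0) :
  \sum_(1 <= n <oo)
     (Shat R n `^ alpha * Normc.normc (A n - A n.-1) ^+ 2 / n%:R ^+ 3)
    >= \sum_(1 <= n <oo) (what alpha n * Normc.normc (A n) ^+ 2)
  /\
  ((exists n, A n != 0) ->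
   \sum_(1 <= n <oo) (what alpha n * Normc.normc (A n) ^+ 2)
    > (alpha - 1) ^+ 2 / 4 *
      \sum_(1 <= n <oo)
         (n%:R ^+ 3 / Shat R n `^ (2 - alpha) * Normc.normc (A n) ^+ 2)).
Proof.
have [N AN] := finitely_supported_bound _ _ hA.
have A2N n : (N <= n)%N -> Normc.normc (A n) ^+ 2 = 0.
  by move=> /AN ->; rewrite Normc.normc0 expr0n.
have wN n : (N <= n)%N -> what alpha n * Normc.normc (A n) ^+ 2 = 0.
  by move=> /A2N ->; rewrite mulr0.
split.
  rewrite (series_finite_support _ _ _ wN).
  (* One more term than for the weights: [A N - A (N - 1)] may be nonzero although [A N = 0]. *)
  rewrite (series_finite_support _ _ N.+1); last first.
    move=> [//|n]; rewrite ltnS => Nn /=.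
    by rewrite !AN ?leqW// subr0 Normc.normc0 expr0n mulr0 mul0r.
  pose v n : R := Shat R n `^ alpha / n%:R ^+ 3.
  pose rho n : R := ((n%:R - 1) / (n%:R + 1)) `^ (1 - alpha).
  pose a n := Normc.normc (A n).
  have ab0 : 1 - alpha != 0 by rewrite gt_eqF//; lra.
  have vge n : (0 < n)%N -> 0 <= v n.
    by move=> _; rewrite divr_ge0 ?powR_ge0 ?exprn_ge0.
  have rhogt n : (1 < n)%N -> 0 < rho n.
    rewrite -(ltr1n R) => n1.
    by rewrite powR_gt0// divr_gt0//; lra.
  have rho1 : rho 1%N = 0 by rewrite /rho subrr mul0r powR0.
  have a0 : a 0%N = 0 by rewrite /a hA0 Normc.normc0.
  have Tge n : (0 < n)%N -> v n * (a n - a n.-1) ^+ 2 <=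
      Shat R n `^ alpha * Normc.normc (A n - A n.-1) ^+ 2 / n%:R ^+ 3.
    move=> n0; rewrite [leRHS]mulrAC -/(v n) ler_wpM2l ?vge//.
    (* Reverse triangle inequality for moduli; viewing values in [Rcomplex R] makes the norm
       real-valued. *)
    rewrite -[leLHS]real_normK ?num_real// lerXn2r ?nnegrE ?normr_ge0//.
      exact: (normr_ge0 (A n - A n.-1 : Rcomplex R)).
    exact: (ler_dist_dist (A n : Rcomplex R) (A n.-1)).
  have := ground_state_partial_sum _ v rho _ _ N vge rhogt rho1 a0 Tge.
  have -> : a N.+1 = 0 by rewrite /a AN// Normc.normc0.
  rewrite expr0n mulr0 addr0; apply: le_trans.
  rewrite le_eqVlt; apply/predU1P; left.
  by apply: eq_big_nat => n /andP[n0 _]; rewrite (what_ground_state _ _ _ n0).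
move=> [m Am].
have m0 : (0 < m)%N by case: m Am => //; rewrite hA0 eqxx.
have mN : (m < N)%N by rewrite ltnNge; apply: contra Am => /AN ->.
rewrite (series_finite_support _ _ _ wN).
rewrite (series_finite_support _ _ N); last first.
  by move=> n /A2N ->; rewrite mulr0.
have ltw n : (0 < n)%N -> 0 < what alpha n -
    (alpha - 1) ^+ 2 / 4 * (n%:R ^+ 3 / Shat R n `^ (2 - alpha)).
  by move=> n0; rewrite subr_gt0 hardy_weight_lt_what.
rewrite mulr_sumr -subr_gt0 -sumrB big_nat_cond.
under eq_bigr do rewrite [X in _ - X]mulrA -mulrBl.
have ge0 n : (0 < n < N.+1)%N && true -> 0 <=
    (what alpha n - (alpha - 1) ^+ 2 / 4 *
       (n%:R ^+ 3 / Shat R n `^ (2 - alpha))) * Normc.normc (A n) ^+ 2.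
  by move=> /andP[/andP[n0 _] _]; rewrite mulr_ge0 ?sqr_ge0// ltW ?ltw.
(* All terms are nonnegative, so the strictly positive one at [m] suffices. *)
rewrite lt_def sumr_ge0// andbT psumr_neq0//.
apply/hasP; exists m; first by rewrite mem_index_iota m0 ltnW.
rewrite m0 ltnW//= mulr_gt0 ?ltw// lt_def sqr_ge0 andbT sqrf_eq0.
by apply: contra Am => /eqP/Normc.eq0_normc ->.
Qed.
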